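(* Let $0<\epsilon<1$, let $p=p(n)$ satisfy $0 \le p(n) \le 1-\epsilon$ for all $n$, and let $r=r(n)$ be a positive integer. If $\frac{p(n)\sqrt{n}}{r(n)\log n} \to \infty$ as $n \to \infty$, then the probability that the random graph $G(n,p)$ fails to contain at least $r$ pairwise edge-disjoint Hamilton cycles is $(1-p)^{(1+o(1))n}$ as $n\to\infty$.
   Context: $G(n,p)$ is the Erdős–Rényi random graph on $n$ vertices in which each pair of vertices is an edge independently with probability $p$. *)

(* Defs.v *)
From mathcomp Require Import all_boot all_order all_algebra.
From mathcomp Require Import all_classical all_reals all_analysis.
Set Implicit Arguments. Unset Strict Implicit. Unset Printing Implicit Defensive.
Import Order.TTheory GRing.Theory Num.Theory.
Local Open Scope ring_scope.

Definition is_graph n (G : {set {set 'I_n}}) : bool :=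
  [forall e in G, #|e| == 2%N].

Definition hamilton_cycle n (H : {set {set 'I_n}}) : bool :=
  (2 < n)%N &&
  [exists f : {ffun 'I_n -> 'I_n},
     injectiveb f && (H == [set [set f i; f (ordS i)] | i : 'I_n])].

Definition has_r_edge_disjoint_ham n (r : nat) (G : {set {set 'I_n}}) : Prop :=
  exists C : 'I_r -> {set {set 'I_n}},
    (forall i, hamilton_cycle (C i) /\ C i \subset G) /\
    (forall i j, i != j -> [disjoint C i & C j]).

(* Probability, in G(n,p), of the event A (a predicate on graphs):
   each of the 'C(n,2) possible edges is present independently w.p. p. *)
Definition gnp_prob (R : realType) n (p : R) (A : {set {set 'I_n}} -> Prop) : R :=
  \sum_(G : {set {set 'I_n}} | is_graph G && `[< A G >])
     p ^+ #|G| * (1 - p) ^+ ('C(n, 2) - #|G|).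

(* Main.v *)
Require Import Defs.
From mathcomp Require Import all_boot zify.
From mathcomp Require Import boolp.
Set Implicit Arguments. Unset Strict Implicit. Unset Printing Implicit Defensive.

(* Lower bound: a fixed vertex is isolated with probability (1-p)^(n-1).

   Upper bound: put k ~ 4 sqrt n. Hamilton cycles are removed greedily. By the
   Chvatal-Erdos theorem the process can only stop before r cycles are found if, after
   fewer than r removals, some vertex set has a boundary of fewer than k vertices or some
   k vertices are independent. As a Hamilton cycle has at most 2|D| edges meeting D,
   this gives disjoint sets D, B between which G itself has at most 2r|D| edges, where
   1 <= |D| <= |B| and either |D| + |B| > n - k or |D| = |B| = k/2. For given D, B this
   has probability at most n^(4r|D|) (1-p)^(|D||B| - 2r|D|). With L = (log n)/p one has
   n <= (1-p)^(-L), while L, r and rL are o(sqrt n) by hypothesis, so the union bound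
   over all D and B is dominated by |D| = 1 and is (1-p)^((1-o(1))n). *)

(** * Cycle extension and the Chvatal-Erdos theorem *)

Lemma next_cat (T : eqType) (x y : T) p1 p2 :
  y \notin x :: p1 -> next (x :: p1 ++ y :: p2) y = head x p2.
Proof.
have H z : y \notin z :: p1 -> next_at y x z (p1 ++ y :: p2) = head x p2.
  elim: p1 z => [|z' p1 IH] z.
    by rewrite inE => /negbTE /= ->; case: p2 => [|? ?]; rewrite /= eqxx.
  by rewrite inE negb_or => /andP[/negbTE /= -> /IH].
exact: H.
Qed.

Section ChvatalErdos.
Variables (T : finType) (e : rel T).
Hypotheses (e_sym : symmetric e) (e_irr : irreflexive e).

Definition boundary (D : {set T}) : {set T} :=
  [set x | (x \notin D) && [exists y in D, e y x]].

(** The first interior vertex [d] is explicit so that a detour is never a bare edge: splicing it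
    into the cycle makes the cycle strictly longer. *)
Definition off_connected (c : seq T) (x y : T) : Prop :=
  exists d s, [/\ path e d s, uniq (d :: s), all [predC c] (d :: s), e x d
    & e (last d s) y].

Lemma off_connected_insert x y c : uniq [:: x, y & c] -> cycle e [:: x, y & c] ->
  off_connected [:: x, y & c] x y ->
  exists2 c', ucycle e c' & size [:: x, y & c] < size c'.
Proof.
move=> Uc Cc [d [s [ds Us sc xd dy]]].
exists (x :: (d :: s) ++ y :: c); last by rewrite /= size_cat /= !addnS !ltnS leq_addl.
apply/andP; split.
  move: Cc => /= /andP[_ yc].
  by rewrite /= rcons_cat cat_path /= xd ds dy.
rewrite -[x :: _]cat1s uniq_catCA cat_uniq Us Uc andbT.
apply/hasPn => z zc; apply/negP => zs.
by move/allP: sc => /(_ z zs) /=; rewrite zc.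
Qed.

(* The new cycle is x ~> y -> .. -> x' -> y' -> .. -> x, where the detour ~> runs off
   [c] and the segment from x' to y is traversed backwards. *)
Lemma off_connected_cross x x' p1 y y' p2 :
  let c := x :: (x' :: p1) ++ y :: y' :: p2 in
  uniq c -> cycle e c -> off_connected c x y -> e x' y' ->
  exists2 c', ucycle e c' & size c < size c'.
Proof.
move=> c Uc Cc [d [s [ds Us sc xd dy]]] x'y'.
(* The new cycle rearranges the detour followed by [c], which settles both its length and the
   distinctness of its vertices. *)
have pe : perm_eq (x :: (d :: s) ++ y :: rev p1 ++ x' :: y' :: p2) ((d :: s) ++ c).
  by apply/permP => a; rewrite /= !(count_cat, count_rev) /= !(count_cat, count_rev) /=; lia.
exists (x :: (d :: s) ++ y :: rev p1 ++ x' :: y' :: p2); last first.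
  by rewrite (perm_size pe) size_cat /= addSn ltnS leq_addl.
apply/andP; split.
  move: Cc; rewrite /c /= => /andP[_].
  rewrite rcons_cat cat_path /= => /and3P[p1x' p1y /andP[yy' p2x]].
  rewrite rcons_cat cat_path /= xd ds dy /=.
  rewrite rcons_cat cat_path /= x'y' p2x !andbT.
  have : path e x' (rcons p1 y) by rewrite rcons_path p1x'.
  rewrite -(eq_path (e := fun z w => e w z)); last by move=> u v; rewrite e_sym.
  rewrite -rev_path last_rcons belast_rcons rev_cons rcons_path.
  by [].
rewrite (perm_uniq pe) cat_uniq Us Uc andbT.
apply/hasPn => z zc; apply/negP => zs.
by move/allP: sc => /(_ z zs) /=; rewrite zc.
Qed.

Lemma off_connected_rot i c x y :
  off_connected c x y -> off_connected (rot i c) x y.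
Proof.
move=> [d [s [h1 h2 h3 h4 h5]]]; exists d, s; split=> //.
by rewrite (eq_all (a2 := [predC c])) // => z /=; rewrite mem_rot.
Qed.

Lemma ucycle_extend_next c x : ucycle e c -> 1 < size c -> x \in c ->
  off_connected c x (next c x) -> exists2 c', ucycle e c' & size c < size c'.
Proof.
move=> /andP[Cc Uc] sc xc.
have [i c2 rc] := rot_to xc.
move/(off_connected_rot i); rewrite -(next_rot i) // -(size_rot i).
rewrite -(size_rot i) in sc; rewrite -(rot_cycle i) in Cc; rewrite -(rot_uniq i) in Uc.
move: sc Cc Uc; rewrite rc; case: c2 {rc} => [|y c2] //= _ Cc Uc.
by rewrite eqxx; apply: off_connected_insert.
Qed.

(** Rotating [x] to the front reduces this to [off_connected_cross]. The degenerate positions, with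
    [y] right after [x] or [x] right after [y], are excluded because the detour would then join a
    vertex to its successor. *)
Lemma ucycle_extend_chord c x y : ucycle e c -> 1 < size c ->
  x \in c -> y \in c -> x != y ->
  off_connected c x y -> ~ off_connected c x (next c x) ->
  ~ off_connected c y (next c y) ->
  off_connected c y x ->
  e (next c x) (next c y) ->
  exists2 c', ucycle e c' & size c < size c'.
Proof.
move=> /andP[Cc Uc] sc xc yc xy oxy nx ny oyx.
have [i c2 rc] := rot_to xc.
rewrite -!(next_rot i Uc) -(size_rot i).
have {}nx : next (rot i c) x <> y.
  by move=> exy; apply: nx; rewrite -(next_rot i Uc) exy.
have {}ny : next (rot i c) y <> x.
  by move=> exy; apply: ny; rewrite -(next_rot i Uc) exy.
have {}oxy := off_connected_rot i oxy.
rewrite -(rot_cycle i) in Cc; rewrite -(rot_uniq i) in Uc.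
rewrite -(mem_rot i) in yc.
rewrite rc in Cc Uc yc oxy nx ny *.
rewrite inE eq_sym (negbTE xy) /= in yc.
case/splitPr: yc Cc Uc oxy nx ny {rc} => p1 p2 Cc Uc oxy nx ny.
case: p1 Cc Uc oxy nx ny => [|x' p1] Cc Uc oxy nx ny; first by case: nx; rewrite /= eqxx.
have nyE : next (x :: (x' :: p1) ++ y :: p2) y = head x p2.
  apply: next_cat.
  by move: Uc; rewrite -cat_cons cat_uniq => /and3P[_ /norP[]].
rewrite nyE in ny *.
case: p2 Cc Uc oxy nx ny nyE => [|y' p2] Cc Uc oxy nx ny nyE; first by case: ny.
have -> : next (x :: (x' :: p1) ++ y :: y' :: p2) x = x' by rewrite /= eqxx.
exact: (off_connected_cross Uc Cc oxy).
Qed.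

(* Let [D] be a component off the cycle [c]. Unless [c] can be extended, the
   boundary of [D], which lies on [c] and separates [D] from the rest of [c], has at
   least [k] vertices, and their successors on [c] together with a vertex of [D] form
   an independent set of more than [k] vertices. *)
Lemma ucycle_extend c k : ucycle e c -> 1 < size c -> size c < #|T| ->
  (forall D x, D != set0 -> x \notin D :|: boundary D -> k <= #|boundary D|) ->
  (forall I : {set T}, {in I &, forall x y, ~~ e x y} -> #|I| <= k) ->
  exists2 c', ucycle e c' & size c < size c'.
Proof.
move=> Cc sc cT cut indep.
have /andP[Cy Uc] := Cc.
have [v vc] : exists v, v \notin c.
  apply/existsP; rewrite -negb_forall; apply: contraTN cT => /forallP h.
  rewrite -leqNgt -(card_uniqP Uc); apply: subset_leq_card.
  by apply/subsetP => x _; apply: h.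
pose e' x y := [&& e x y, x \notin c & y \notin c].
have e'_sym : symmetric e' by move=> x y; rewrite /e' e_sym [(x \notin c) && _]andbC.
pose D := [set y | connect e' v y].
have vD : v \in D by rewrite inE connect0.
have Dc x : x \in D -> x \notin c.
  rewrite inE => /connectP[p]; case: (lastP p) => [|q y] //=; first by move=> _ ->.
  by rewrite rcons_path last_rcons => /andP[_ /and3P[_ _ ?]] ->.
have Nc x : x \in boundary D -> x \in c.
  rewrite inE => /andP[xD /existsP[y /andP[yD yx]]].
  apply: contraR xD => xc; rewrite inE.
  move: (yD); rewrite inE => /connect_trans; apply; apply: connect1.
  by rewrite /e' yx xc Dc.
have off x y : x \in boundary D -> y \in boundary D -> off_connected c x y.
  rewrite inE => /andP[_ /existsP[d /andP[dD dx]]].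
  rewrite inE => /andP[_ /existsP[d' /andP[d'D d'y]]].
  have : connect e' d d'.
    rewrite inE in dD; rewrite inE in d'D.
    by apply: connect_trans d'D; rewrite (sym_connect_sym e'_sym).
  case/connectP => p /shortenP[p' dp' Up' _] d'E.
  exists d, p'; rewrite -d'E; split => //; last by rewrite e_sym.
  - by apply: sub_path dp' => a b /and3P[].
  - rewrite /= Dc //=; elim: p' d dp' {dx dD Up' d'E} => //= a p' IH d.
    by move=> /andP[/and3P[_ _ ->]] /IH.
have [//|short] := pselect (exists2 c', ucycle e c' & size c < size c').
have nextN x : x \in boundary D -> next c x \notin boundary D.
  move=> xN; apply/negP => nN; apply: short.
  by apply: (ucycle_extend_next Cc sc (Nc _ xN)); apply: off.
have notD x : x \in c -> x \notin D by apply: contraL => /Dc.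
have out x : x \in c -> x \notin boundary D -> k <= #|boundary D|.
  move=> xc xN; apply: (cut _ x); last by rewrite inE negb_or notD.
  by apply/set0Pn; exists v.
(* A cycle vertex outside the boundary is wanted: the successor of a boundary vertex, or any cycle
   vertex if the boundary is empty. *)
have kN : k <= #|boundary D|.
  have [N0|[x xN]] := set_0Vmem (boundary D); last first.
    by apply: (out (next c x)); rewrite ?mem_next ?Nc ?nextN.
  case: (c) sc out => // x c' _ /(_ x); rewrite mem_head N0 inE; exact.
pose I := v |: [set next c x | x in boundary D].
have : #|I| <= k.
  apply: indep => x y.
  have vnext z : z \in boundary D -> ~~ e v (next c z).
    move=> zN; apply: contra (nextN z zN) => ez.
    rewrite inE notD ?mem_next ?Nc //; by apply/existsP; exists v; rewrite vD.
  case/setU1P => [->|/imsetP[x0 xN ->]]; case/setU1P => [->|/imsetP[y0 yN ->]].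
  - by rewrite e_irr.
  - exact: vnext.
  - by rewrite e_sym vnext.
  have [->|xy] := eqVneq x0 y0; first by rewrite e_irr.
  apply/negP => exy; apply: (short).
  apply: (ucycle_extend_chord Cc sc (Nc _ xN) (Nc _ yN)) => //; try exact: off.
  - by move=> /(ucycle_extend_next Cc sc (Nc _ xN))/short.
  - by move=> /(ucycle_extend_next Cc sc (Nc _ yN))/short.
rewrite cardsU1 card_imset; last exact: can_inj (prev_next Uc).
have -> : v \notin [set next c x | x in boundary D].
  by apply/imsetP => -[x xN vE]; move: vc; rewrite vE mem_next Nc.
by rewrite add1n ltnNge kN.
Qed.

(* The Chvatal-Erdos theorem. *)
Lemma ucycle_spanning k : 0 < k -> 1 < #|T| ->
  (forall D x, D != set0 -> x \notin D :|: boundary D -> k <= #|boundary D|) ->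
  (forall I : {set T}, {in I &, forall x y, ~~ e x y} -> #|I| <= k) ->
  exists2 c, ucycle e c & size c = #|T|.
Proof.
move=> k0 T1 cut indep.
have [x [y exy]] : exists x y, e x y.
  have [x [y [_ _ xy]]] := card_gt1P T1.
  (* An isolated [x] would have empty boundary and contradict [cut], as [k] is positive. *)
  have [N0|[z]] := set_0Vmem (boundary [set x]); last first.
    by rewrite inE => /andP[_ /existsP[w /andP[_ wz]]]; exists w, z.
  have := cut [set x] y; rewrite N0 cards0 setU0 inE (eq_sym y) xy leqn0.
  rewrite (negbTE (lt0n_neq0 k0)) => h; suff: false by [].
  by apply: h => //; apply/set0Pn; exists x; rewrite inE.
(* Extension starts from an edge traversed back and forth, which counts as a cycle of length two for
   [ucycle]. *)
have ec : ucycle e [:: x; y].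
  rewrite /ucycle /= exy e_sym exy /= inE andbT.
  by apply: contraTneq exy => ->; rewrite e_irr.
suff H m c : #|T| - size c <= m -> ucycle e c -> 1 < size c ->
    exists2 c, ucycle e c & size c = #|T|.
  exact: (H _ [:: x; y] (leqnn _)).
elim: m c => [|m IH] c sm Cc sc; have cT : size c <= #|T|
    by case/andP: (Cc) => _ /card_uniqP <-; apply: max_card.
  by exists c => //; lia.
have [{}cT|Tc] := ltnP (size c) #|T|; last by exists c => //; lia.
have [c' Cc' cc'] := ucycle_extend Cc sc cT cut indep.
apply: (IH c') => //; lia.
Qed.

End ChvatalErdos.

(** * Edges across a cut and greedy removal of Hamilton cycles *)

Lemma exists_subset_card (T : finType) (B : {set T}) m :
  m <= #|B| -> exists2 A : {set T}, A \subset B & #|A| = m.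
Proof.
rewrite -bin_gt0 -cards_draws card_gt0 => /set0Pn[A].
by rewrite inE => /andP[AB /eqP Am]; exists A.
Qed.

Section Cross.
Variable n : nat.
Implicit Types (D B U : {set 'I_n}) (G H : {set {set 'I_n}}).

Definition cross D B : {set {set 'I_n}} :=
  [set [set xy.1; xy.2] | xy in setX D B].

Lemma crossP D B h :
  reflect (exists x y, [/\ x \in D, y \in B & h = [set x; y]]) (h \in cross D B).
Proof.
apply: (iffP imsetP) => [[[x y]]|[x [y [xD yB ->]]]].
  by rewrite inE => /andP[xD yB ->]; exists x, y.
by exists (x, y); rewrite // inE xD.
Qed.

Lemma card_cross D B : [disjoint D & B] -> #|cross D B| = #|D| * #|B|.
Proof.
move=> DB; rewrite card_in_imset ?cardsX // => -[x y] [x' y'] /=.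
rewrite !inE /= => /andP[xD yB] /andP[x'D y'B] E.
have nDB z : z \in D -> z \in B -> False.
  by move=> zD zB; have := disjointFr DB zD; rewrite zB.
have : x \in [set x'; y'] by rewrite -E !inE eqxx.
have : y \in [set x'; y'] by rewrite -E !inE eqxx orbT.
rewrite !inE => /orP[]/eqP yE; first by case: (nDB y); rewrite // yE.
case/orP => /eqP xE; last by case: (nDB x); rewrite // xE.
by rewrite xE yE.
Qed.

Lemma hamilton_cycle_ucycle G (c : seq 'I_n) : 2 < n ->
  ucycle (fun x y => [set x; y] \in G) c -> size c = n ->
  exists2 H, hamilton_cycle H & H \subset G.
Proof.
case: n G c => // m G c n2 /andP[Cc Uc] sc.
pose f := [ffun i : 'I_m.+1 => nth ord0 c i].
exists [set [set f i; f (ordS i)] | i : 'I_m.+1].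
  rewrite /hamilton_cycle n2; apply/existsP; exists f; rewrite eqxx andbT.
  apply/injectiveP => i j; rewrite !ffunE => /eqP.
  by rewrite nth_uniq ?sc ?ltn_ord // => /eqP /val_inj.
apply/subsetP => _ /imsetP[i _ ->]; rewrite !ffunE {f}.
case: c Cc Uc sc => // x c /= /(pathP ord0) Cc _ [sc].
have := Cc i; rewrite size_rcons sc ltn_ord => /(_ isT).
rewrite -rcons_cons !nth_rcons /= sc ltn_ord.
have := ltn_ord i; rewrite ltnS leq_eqVlt => /orP[/eqP iE|im].
  by rewrite iE modnn ltnn eqxx.
by rewrite modn_small ?ltnS // im.
Qed.

(** An edge of [H] meeting [D] does so in its first or its second endpoint along [f], and each case
    accounts for at most one edge per vertex of [D]. *)
Lemma card_hamilton_cycle_cross H D B : hamilton_cycle H ->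
  #|H :&: cross D B| <= 2 * #|D|.
Proof.
move=> /andP[_ /existsP[f /andP[/injectiveP finj /eqP HE]]].
pose h i := [set f i; f (ordS i)].
have cardpre (g : 'I_n -> 'I_n) : injective g -> #|[set i | g i \in D]| <= #|D|.
  move=> ginj; rewrite -(card_imset _ ginj); apply: subset_leq_card.
  by apply/subsetP => _ /imsetP[i + ->]; rewrite inE.
have sub : H :&: cross D B \subset
    h @: [set i | f i \in D] :|: h @: [set i | f (ordS i) \in D].
  apply/subsetP => e; rewrite inE HE => /andP[/imsetP[i _ eE]] /crossP[x [y [xD _]]] E.
  have : x \in [set f i; f (ordS i)] by rewrite -eE E !inE eqxx.
  rewrite eE !inE => /orP[]/eqP xE; apply/orP; [left|right];
    by apply: imset_f; rewrite inE -xE.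
apply: leq_trans (subset_leq_card sub) _.
rewrite mul2n -addnn (leq_trans (leq_card_setU _ _)) // leq_add //;
  rewrite (leq_trans (leq_imset_card _ _)) // cardpre //.
by move=> i j /finj /ordS_inj.
Qed.

(* The first alternative tests the boundary of a set for having fewer than [k]
   vertices ([U] is the complement of that boundary), the second tests an independent
   set [U] of [k] vertices, split into two halves. *)
Definition admissible k U D : bool :=
  [&& D \subset U, 0 < #|D|, 2 * #|D| <= #|U|
    & (n - #|U| < k) || (#|U| == k) && (2 * #|D| == k)].

(** The threshold is the most that [r] Hamilton cycles can remove from the cut, so an edge survives
    every stage of the greedy removal. *)
Definition robust k r G : Prop :=
  forall U D, admissible k U D -> 2 * r * #|D| < #|G :&: cross D (U :\: D)|.

Lemma robust_cross k r G j (C : nat -> {set {set 'I_n}}) U D : robust k r G -> j <= r ->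
  (forall i, i < j -> hamilton_cycle (C i)) -> admissible k U D ->
  (G :\: \bigcup_(i < j) C i) :&: cross D (U :\: D) != set0.
Proof.
move=> rob jr ham adm; apply: contraTneq (rob U D adm) => E.
have sub : G :&: cross D (U :\: D) \subset
    \bigcup_(i < j) (C i :&: cross D (U :\: D)).
  apply/subsetP => h /setIP[hG hX].
  have : h \notin (G :\: \bigcup_(i < j) C i) :&: cross D (U :\: D) by rewrite E inE.
  rewrite !inE hX hG !andbT negbK => /bigcupP[i _ hi].
  by apply/bigcupP; exists i; rewrite // inE hi.
rewrite -leqNgt (leq_trans (subset_leq_card sub)) //.
have -> : 2 * r * #|D| = r * (2 * #|D|) by lia.
apply: (@leq_trans (\sum_(i < j) 2 * #|D|)); last first.
  by rewrite sum_nat_const card_ord leq_mul2r jr orbT.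
apply: (@leq_trans (\sum_(i < j) #|C i :&: cross D (U :\: D)|)); last first.
  by apply: leq_sum => i _; apply/card_hamilton_cycle_cross/ham.
elim/big_rec2: _ => [|i m A _ IH]; first by rewrite cards0.
by rewrite (leq_trans (leq_card_setU _ _)) // leq_add2l.
Qed.

(** The remaining graph satisfies the hypotheses of [ucycle_spanning] with k = 2a: a small boundary
    or a large independent set would give an admissible pair without a surviving edge. The parameter
    is even so that an independent set can be halved. *)
Lemma robust_hamilton a r G j (C : nat -> {set {set 'I_n}}) :
  2 < n -> 0 < a -> is_graph G -> robust (2 * a) r G -> j <= r ->
  (forall i, i < j -> hamilton_cycle (C i)) ->
  exists2 H, hamilton_cycle H & H \subset G :\: \bigcup_(i < j) C i.
Proof.
move=> n2 a0 /forallP gG rob jr ham.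
set G' := _ :\: _.
pose e x y := [set x; y] \in G'.
have e_sym : symmetric e by move=> x y; rewrite /e setUC.
have e_irr : irreflexive e.
  move=> x; apply/negbTE; rewrite /e setUid inE negb_and; apply/orP; right.
  by apply/negP => h; have := gG [set x]; rewrite h cards1.
have adm_edge U D : admissible (2 * a) U D -> exists x y, [/\ x \in D, y \in U :\: D & e x y].
  move=> /(robust_cross rob jr ham) /set0Pn[h /setIP[hG' /crossP[x [y [xD yB hE]]]]].
  by exists x, y; rewrite /e -hE.
have cut D x : D != set0 -> x \notin D :|: boundary e D -> 2 * a <= #|boundary e D|.
  move=> D0; rewrite inE negb_or => /andP[xD xN]; rewrite leqNgt; apply/negP => small.
  pose U := ~: boundary e D.
  have DU : D \subset U.
    by apply/subsetP => y yD; rewrite !inE yD.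
  have xU : x \in U by rewrite inE.
  have noedge y z : y \in D -> z \in U :\: D -> ~~ e y z.
    move=> yD; rewrite !inE => /andP[zD]; rewrite zD /=; apply: contra => yz.
    by apply/existsP; exists y; rewrite yD.
  have cU : n - #|U| < 2 * a.
    by rewrite /U cardsCs setCK card_ord; lia.
  have cUD : #|U :\: D| = #|U| - #|D| by rewrite cardsD (setIidPr DU).
  have D1 : 0 < #|D| by rewrite card_gt0.
  have UD1 : 0 < #|U :\: D| by rewrite card_gt0; apply/set0Pn; exists x; rewrite inE xD.
  (* Admissibility asks for the smaller side of the cut, which may be [D] or [U :\: D]. *)
  have [h|h] := leqP (2 * #|D|) #|U|.
    have [|y [z [yD zU yz]]] := adm_edge U D; first by rewrite /admissible DU D1 h cU.
    by have := noedge _ _ yD zU; rewrite yz.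
  have [|y [z [yD zU yz]]] := adm_edge U (U :\: D).
    rewrite /admissible subsetDl UD1 cU cUD /= andbT; move: #|U| #|D| h => u d; clear; lia.
  have zD : z \in D by move: zU; rewrite !inE; case: (z \in D); rewrite //= ?andbT andNb.
  by have := noedge _ _ zD yD; rewrite e_sym yz.
have indep (I : {set 'I_n}) : {in I &, forall x y, ~~ e x y} -> #|I| <= 2 * a.
  move=> ind; rewrite leqNgt; apply/negP => big.
  have [U UI cU] := exists_subset_card (ltnW big).
  have [|D DU cD] := @exists_subset_card _ U a; first by rewrite cU; lia.
  have [|x [y [xD yU xy]]] := adm_edge U D.
    by rewrite /admissible DU cD a0 cU leqnn !eqxx orbT.
  move: yU; rewrite inE => /andP[_ yU].
  by have := ind _ _ (subsetP UI _ (subsetP DU _ xD)) (subsetP UI _ yU); rewrite xy.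
have [||c Cc sc] := ucycle_spanning e_sym e_irr _ _ cut indep; rewrite ?card_ord //.
- by rewrite muln_gt0.
- exact: ltnW.
apply: hamilton_cycle_ucycle n2 Cc _; by rewrite sc card_ord.
Qed.

Lemma robust_has_r_edge_disjoint_ham a r G :
  2 < n -> 0 < a -> is_graph G -> robust (2 * a) r G -> has_r_edge_disjoint_ham r G.
Proof.
move=> n2 a0 gG rob.
have [C [CG disj]] : exists C : nat -> {set {set 'I_n}},
    (forall i, i < r -> hamilton_cycle (C i) /\ C i \subset G) /\
    (forall i j, i < j < r -> [disjoint C i & C j]).
  suff H j : j <= r -> exists C : nat -> {set {set 'I_n}},
      (forall i, i < j -> hamilton_cycle (C i) /\ C i \subset G) /\
      (forall i i', i < i' < j -> [disjoint C i & C i']).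
    exact: H.
  elim: j => [|j IH] jr.
    by exists (fun=> set0); split=> // i i'; rewrite ltn0 andbF.
  have [C [CG disj]] := IH (ltnW jr).
  have [|H hamH HG] := robust_hamilton n2 a0 gG rob (ltnW jr) (C := C).
    by move=> i /CG[].
  have CH i : i < j -> [disjoint C i & H].
    move=> ij; rewrite disjoint_sym disjoints_subset; apply: subset_trans HG _.
    apply/subsetP => h; rewrite !inE => /andP[+ _]; apply: contra => hC.
    by apply/bigcupP; exists (Ordinal ij).
  (* Indexing by [nat] lets the greedy step simply overwrite the value at [j]. *)
  exists (fun i => if i == j then H else C i); split => [i|i i'].
    rewrite ltnS leq_eqVlt; case: eqP => [_ _|_ /CG //].
    by split=> //; apply: subset_trans HG (subsetDl _ _).
  case/andP => ii'; rewrite ltnS leq_eqVlt.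
  case: (eqVneq i' j) ii' => [-> ij _|_ ii' /= i'j]; rewrite ltn_eqF //.
  - exact: CH.
  - by apply: disj; rewrite ii'.
  - exact: ltn_trans i'j.
exists (fun i : 'I_r => C i); split => [i|i j ij]; first exact: CG.
have [ij'|ij'|/val_inj ij'] := ltngtP i j; last by rewrite ij' eqxx in ij.
- by apply: disj; rewrite ij' /=.
- by rewrite disjoint_sym; apply: disj; rewrite ij' /=.
Qed.

End Cross.

From mathcomp Require Import all_order all_algebra.
From mathcomp Require Import all_classical all_reals all_analysis.
From mathcomp Require Import ring lra.
Import Order.TTheory GRing.Theory Num.Theory.
Import numFieldNormedType.Exports.
Local Open Scope ring_scope.

(** * Union bounds and elementary probabilities in G(n,p) *)

Lemma sum_subset_binomial (R : comPzRingType) (T : finType) (Y : {set T}) (p q : R) :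
  \sum_(G : {set T} | G \subset Y) p ^+ #|G| * q ^+ (#|Y| - #|G|) = (q + p) ^+ #|Y|.
Proof.
rewrite exprDn (partition_big (fun G : {set T} => inord #|G| : 'I_#|Y|.+1) xpredT) //=.
apply: eq_bigr => i _; rewrite -cards_draws -sumr_const.
rewrite (eq_bigl [in [set A : {set T} | A \subset Y & #|A| == i]]); last first.
  move=> G; rewrite inE; case GY: (G \subset Y) => //=.
  by rewrite -val_eqE /= inordK // ltnS subset_leq_card.
by apply: eq_bigr => G; rewrite inE => /andP[_ /eqP ->]; rewrite mulrC.
Qed.

Section Gnp.
Variables (R : realType) (n : nat) (p : R).
Hypotheses (p0 : 0 <= p) (p1 : p <= 1).
Implicit Types (G X : {set {set 'I_n}}) (A B : {set {set 'I_n}} -> Prop).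

Let edges : {set {set 'I_n}} := [set h : {set 'I_n} | #|h| == 2%N].
Let weight G : R := p ^+ #|G| * (1 - p) ^+ ('C(n, 2) - #|G|).

Lemma is_graph_subset G : is_graph G = (G \subset edges).
Proof.
apply/forallP/fintype.subsetP => [gG h hG|gG h]; first by rewrite inE; apply: implyP (gG h) hG.
by apply/implyP => /gG; rewrite inE.
Qed.

Lemma card_edges : #|edges| = 'C(n, 2).
Proof. by rewrite card_draws card_ord. Qed.

Lemma weight_ge0 G : 0 <= weight G.
Proof. by rewrite mulr_ge0 // exprn_ge0 // subr_ge0. Qed.

Lemma gnp_prob_le A B : (forall G, is_graph G -> A G -> B G) ->
  gnp_prob p A <= gnp_prob p B.
Proof.
move=> AB; rewrite /gnp_prob [leRHS](bigID (fun G => `[< A G >])) /=.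
apply: ler_wpDr; first by apply: sumr_ge0 => G _; apply: weight_ge0.
rewrite le_eqVlt; apply/orP; left; apply/eqP; apply: eq_bigl => G.
case gG: (is_graph G) => //=; apply/idP/andP => [/asboolP aG|[]//].
by split; apply/asboolP => //; apply: AB.
Qed.

Lemma gnp_prob_union_le (I : finType) (Q : pred I) (E : I -> {set {set 'I_n}} -> Prop) :
  gnp_prob p (fun G => exists2 i, Q i & E i G) <= \sum_(i | Q i) gnp_prob p (E i).
Proof.
rewrite /gnp_prob (exchange_big_dep (@is_graph n)) /=; last by move=> i G _ /andP[].
rewrite [leRHS](bigID (fun G => `[< exists2 i, Q i & E i G >])) /=.
apply: ler_wpDr.
  by apply: sumr_ge0 => G _; apply: sumr_ge0 => i _; apply: weight_ge0.
apply: ler_sum => G /andP[gG /asboolP[i Qi EiG]].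
rewrite (bigD1 i) /=; last by rewrite Qi gG; apply/asboolP.
by rewrite lerDl; apply: sumr_ge0 => j _; apply: weight_ge0.
Qed.

(** Graphs avoiding [X] are the subsets of the other pairs. Once (1-p)^|X| is factored out, the
    total mass of the random graph on those pairs is left, and it is 1. *)
Lemma gnp_prob_avoid X : X \subset edges ->
  gnp_prob p (fun G => G :&: X = finset.set0) = (1 - p) ^+ #|X|.
Proof.
move=> XE; rewrite /gnp_prob.
rewrite (eq_bigl (fun G => G \subset edges :\: X)); last first.
  move=> G; rewrite is_graph_subset subsetD -setI_eq0; congr (_ && _).
  by apply/asboolP/eqP.
have cX : (#|edges :\: X| + #|X| = 'C(n, 2))%N.
  by rewrite -card_edges cardsD (finset.setIidPr XE) subnK // subset_leq_card.
rewrite (eq_bigr (fun G => (1 - p) ^+ #|X| *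
    (p ^+ #|G| * (1 - p) ^+ (#|edges :\: X| - #|G|)))); last first.
  move=> G /subset_leq_card cG; rewrite mulrCA -exprD; congr (_ * _ ^+ _).
  by move: #|G| #|edges :\: X| #|X| cG cX; lia.
by rewrite -mulr_sumr sum_subset_binomial subrK expr1n mulr1.
Qed.

(* Union bound over lists [g] of [m] vertex pairs covering [G :&: X]. *)
Lemma gnp_prob_few m X : (0 < n)%N -> X \subset edges ->
  gnp_prob p (fun G => (#|G :&: X| <= m)%N) <=
    n%:R ^+ (2 * m) * (1 - p) ^+ (#|X| - m).
Proof.
move=> n0 XE; pose x0 : 'I_n := Ordinal n0.
pose im (g : {ffun 'I_m -> 'I_n * 'I_n}) := [set [set (g i).1; (g i).2] | i : 'I_m]%SET.
pose E (g : {ffun 'I_m -> 'I_n * 'I_n}) G := G :&: (X :\: im g) = finset.set0.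
apply: (@le_trans _ _ (gnp_prob p (fun G => exists2 g, xpredT g & E g G))).
  apply: gnp_prob_le => G _ Gm.
  pose ends (h : {set 'I_n}) := odflt (x0, x0) [pick xy | h == [set xy.1; xy.2]%SET].
  have endsE h : h \in edges -> h = [set (ends h).1; (ends h).2]%SET.
    rewrite inE => /cards2P[x [y [_ hE]]]; rewrite /ends; case: pickP => [xy /eqP //|].
    by move=> /(_ (x, y)) /eqP /(_ hE).
  (* The list enumerates the edges of [G :&: X]. Entries past the end are padding, harmless since
     only covering matters. *)
  exists [ffun i : 'I_m => ends (nth finset.set0 (enum (G :&: X)) i)] => //.
  apply/eqP; rewrite -finset.subset0; apply/fintype.subsetP => h.
  rewrite !inE => /and3P[hG him hX]; case/negP: him.
  have hGX : h \in enum (G :&: X) by rewrite mem_enum inE hG.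
  have hm : (seq.index h (enum (G :&: X)) < m)%N.
    by apply: leq_trans Gm; rewrite cardE index_mem.
  apply/imsetP; exists (Ordinal hm) => //; rewrite ffunE /= nth_index //.
  by apply: endsE; apply: (fintype.subsetP XE).
apply: le_trans (gnp_prob_union_le _ _) _.
apply: (@le_trans _ _ (\sum_(g : {ffun 'I_m -> 'I_n * 'I_n}) (1 - p) ^+ (#|X| - m))).
  apply: ler_sum => g _; rewrite gnp_prob_avoid; last first.
    exact: fintype.subset_trans (subsetDl _ _) XE.
  apply: ler_wiXn2l; rewrite ?subr_ge0 ?lerBlDr ?lerDl //.
  rewrite cardsD leq_sub2l //; apply: leq_trans (subset_leq_card (subsetIr _ _)) _.
  by apply: leq_trans (leq_imset_card _ _) _; rewrite card_ord.
rewrite sumr_const card_ffun card_prod !card_ord -[leLHS]mulr_natl.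
by rewrite natrX natrM -expr2 -exprM.
Qed.

End Gnp.

(* The sum equals (1 + 1/n)^n. Weighting each set [V] by n^-|V| turns the union bounds
   over vertex sets below into geometric ones, without sorting by cardinality. *)
Lemma sum_subset_inv_card (R : realType) n : (0 < n)%N ->
  \sum_(V : {set 'I_n}) (n%:R ^- #|V| : R) <= expR 1.
Proof.
move=> n0; have := @sum_subset_binomial R 'I_n finset.setT n%:R^-1 1.
rewrite (eq_bigl xpredT); last by move=> V; rewrite finset.subsetT.
under eq_bigr do rewrite expr1n mulr1 exprVn.
move=> ->; rewrite cardsT card_ord.
have n0' : n%:R != 0 :> R by rewrite pnatr_eq0 -lt0n.
have -> : expR 1 = expR (n%:R^-1) ^+ n :> R by rewrite -expRM_natl mulfV.
by apply: lerXn2r (expR_ge1Dx _); rewrite nnegrE ?expR_ge0 // addr_ge0 ?invr_ge0.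
Qed.

Lemma ler_sum1_subset (R : numDomainType) (I : finType) (P Q : pred I) :
  (forall i, P i -> Q i) -> \sum_(i | P i) 1 <= \sum_(i | Q i) 1 :> R.
Proof.
move=> PQ; rewrite [leLHS]big_mkcond [leRHS]big_mkcond; apply: ler_sum => i _.
by case: ifP => [/PQ ->|_]; [|case: ifP].
Qed.

(** Either [U] or its complement has at most [k] elements, hence the factor 2. Each set of at most
    [k] elements has weight at least n^-k in [sum_subset_inv_card]. *)
Lemma card_admissible_supersets_le (R : realType) n k : (0 < n)%N ->
  (\sum_(U : {set 'I_n} | (n - #|U| < k)%N || (#|U| == k)) 1 : R)
    <= 2 * expR 1 * n%:R ^+ k.
Proof.
move=> n0; have n1 : 1 <= n%:R :> R by rewrite ler1n.
have small : (\sum_(V : {set 'I_n} | (#|V| <= k)%N) 1 : R) <= expR 1 * n%:R ^+ k.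
  apply: le_trans (ler_wpM2r _ (sum_subset_inv_card R n0)); last by rewrite exprn_ge0.
  rewrite mulr_suml [leRHS](bigID (fun V : {set 'I_n} => (#|V| <= k)%N)) /=.
  apply: ler_wpDr.
    by apply: sumr_ge0 => V _; rewrite mulr_ge0 // ?invr_ge0 exprn_ge0.
  apply: ler_sum => V Vk; rewrite ler_pdivlMl ?exprn_gt0 ?ltr0n // mulr1.
  exact: ler_weXn2l.
apply: (@le_trans _ _ ((\sum_(U : {set 'I_n} | (n - #|U| < k)%N) 1) +
    \sum_(U : {set 'I_n} | #|U| == k) 1)).
  rewrite [leLHS]big_mkcond [X in X + _]big_mkcond [X in _ + X]big_mkcond -big_split /=.
  by apply: ler_sum => U _; case: (_ < _)%N; case: (_ == _);
    rewrite /= ?addr0 ?add0r ?lerDl.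
rewrite -mulrA mulr_natl mulr2n; apply: lerD.
  rewrite (reindex_inj (@finset.setC_inj _)) /=.
  apply: le_trans small; apply: ler_sum1_subset => U /=.
  by have := cardsC U; rewrite card_ord; move: #|U| #|~: U|%SET => x y; lia.
by apply: le_trans small; apply: ler_sum1_subset => U /= /eqP ->.
Qed.

(** The star [X] at a vertex [x0] has n-1 pairs, and any Hamilton cycle contains one of them. *)
Lemma gnp_prob_no_ham_ge (R : realType) (n r : nat) (p : R) :
  0 <= p -> p < 1 -> (0 < n)%N -> (0 < r)%N ->
  (1 - p) ^+ n.-1 <= gnp_prob p (fun G : {set {set 'I_n}} => ~ has_r_edge_disjoint_ham r G).
Proof.
move=> p0 p1 n0 r0; pose x0 : 'I_n := Ordinal n0.
pose X := cross [set x0]%SET [set~ x0]%SET.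
have cX : #|X| = n.-1.
  rewrite card_cross ?cards1 ?mul1n ?cardsC1 ?card_ord //.
  by rewrite -setI_eq0; apply/eqP/setP => x; rewrite !inE; case: eqP.
rewrite -cX -gnp_prob_avoid //; last 1 first.
  apply/fintype.subsetP => h /crossP[x [y [+ +]]].
  by rewrite !inE => /eqP -> yx ->; rewrite cards2 (eq_sym x0) yx.
- apply: gnp_prob_le => //; first exact: ltW.
  move=> G _ GX [C [/(_ (Ordinal r0))[/andP[n2 /existsP[f /andP[+ /eqP CE]]] CG] _]].
  move=> /injectiveP finj.
  have [i fi] : exists i, f i = x0.
    by exists (invF finj x0); rewrite f_invF.
  pose h : {set 'I_n} := [set f i; f (ordS i)]%SET.
  have hG : h \in G by apply: (fintype.subsetP CG); rewrite CE; apply: imset_f.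
  have : h \in G :&: X.
    rewrite inE hG; apply/crossP; exists x0, (f (ordS i)).
    (* The cyclic successor of [i] could equal [i] only for n = 1. *)
    split; rewrite ?inE // /h ?fi // -fi; apply/eqP => /finj /(congr1 val) /= E.
    have [iS|iS] := ltnP i.+1 n; first by move: E; rewrite modn_small //; lia.
    have iE : i.+1 = n by apply/eqP; rewrite eqn_leq iS ltn_ord.
    by move: E; rewrite iE modnn; move: (nat_of_ord i) iE n2; lia.
  by rewrite GX inE.
exact: ltW.
Qed.

(** * Union bound over all admissible cuts *)

Section Tail.
Variables (R : realType) (n : nat) (p L : R).
Let q := 1 - p.
Hypotheses (p0 : 0 <= p) (p1 : p < 1) (n0 : (0 < n)%N) (L0 : 0 <= L).
Hypothesis nL : n%:R <= q `^ (- L).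

Lemma natX_le_powR m : n%:R ^+ m <= q `^ (- (m%:R * L)).
Proof.
rewrite mulrC -mulNr powRrM powR_mulrn ?powR_ge0 //.
by apply: lerXn2r; rewrite ?nnegrE ?powR_ge0.
Qed.

(** Natural subtraction truncates at 0, but then the real exponent is negative and the right side is
    at least 1. *)
Lemma exprB_le_powR m j : q ^+ (m - j) <= q `^ (m%:R - j%:R).
Proof.
have q0 : 0 < q by rewrite subr_gt0.
have q1 : q <= 1 by rewrite lerBlDr lerDl.
have [jm|mj] := leqP j m; first by rewrite -natrB // powR_mulrn // ltW.
have -> : (m - j = 0)%N by move: mj; lia.
rewrite expr0 -[leLHS](powRr0 q); apply: ger_powR; rewrite ?q0 ?q1 //.
by rewrite subr_le0 ler_nat ltnW.
Qed.

(** With u = |U| and a = |D|, every power of n is traded for a power of [q] at the price [L] each.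
    Of these, 4ra come from [gnp_prob_few], a from the weights in the sum over [D], k from the
    number of sets [U], and 3 absorb the constant 2 e^2. *)
Lemma gnp_prob_not_robust k r (E : R) : expR 1 <= n%:R :> R -> (2 <= n)%N ->
  (forall u a : nat, (0 < a)%N -> (2 * a <= u <= n)%N ->
     (n - u < k)%N || (u == k) && (2 * a == k)%N ->
     E <= a%:R * (u%:R - a%:R) - (2 * r * a)%:R - (4 * r * a + a + k + 3)%:R * L) ->
  gnp_prob p (fun G : {set {set 'I_n}} => ~ robust k r G) <= q `^ E.
Proof.
move=> en n2 HE.
have q0 : 0 < q by rewrite subr_gt0.
have q1 : q <= 1 by rewrite lerBlDr lerDl.
have N0 : 0 < n%:R :> R by rewrite ltr0n.
pose term (U D : {set 'I_n}) : R := n%:R ^+ (2 * (2 * r * #|D|)) *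
  q ^+ (#|D| * (#|U| - #|D|) - 2 * r * #|D|).
apply: (@le_trans _ _ (\sum_(UD | admissible k UD.1 UD.2) term UD.1 UD.2)).
  apply: (@le_trans _ _ (gnp_prob p (fun G => exists2 UD, admissible k UD.1 UD.2 &
     (#|G :&: cross UD.2 (UD.1 :\: UD.2)| <= 2 * r * #|UD.2|)%N))).
    apply: gnp_prob_le => // [|G _ nr]; first exact: ltW.
    apply: contrapT => h; apply: nr => U D adm; rewrite ltnNge; apply/negP => le.
    by apply: h; exists (U, D).
  apply: le_trans (gnp_prob_union_le _ _ _ _) _ => //; first exact: ltW.
  apply: ler_sum => -[U D] /= adm; have /and4P[DU _ _ _] := adm.
  apply: le_trans (gnp_prob_few _ _ _ _ _) _ => //; first exact: ltW.
    apply/fintype.subsetP => h /crossP[x [y [xD]]].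
    by rewrite !inE => /andP[yD _] ->; rewrite cards2 (contraNneq _ yD) // => <-.
  rewrite card_cross ?cardsD ?(finset.setIidPr DU) //.
  by rewrite -setI_eq0; apply/eqP/setP => x; rewrite !inE; case: (x \in D).
have termE U D : admissible k U D ->
    term U D <= q `^ E * n%:R ^- #|D| * n%:R ^- (k + 3).
  move=> /and4P[DU D0 DU2 UDk].
  have DUn : (2 * #|D| <= #|U| <= n)%N by rewrite DU2 -[leqRHS]card_ord max_card.
  rewrite -mulrA -invfM -exprD ler_pdivlMr ?exprn_gt0 //.
  rewrite /term mulrAC -exprD.
  apply: (le_trans (ler_pM _ _ (natX_le_powR _) (exprB_le_powR _ _)));
    rewrite ?exprn_ge0 // ?(ltW q0) //.
  rewrite -powRD; last by rewrite (gt_eqF q0) implybT.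
  apply: ger_powR; first by rewrite q0 q1.
  apply: le_trans (HE _ _ D0 DUn UDk) _.
  rewrite (natrM _ #|D| (#|U| - #|D|)) natrB; last by move: DU2; move: #|D| #|U| => x y; lia.
  rewrite [leRHS]addrC lerD2l lerN2; apply: ler_wpM2r => //; rewrite ler_nat.
  by move: #|D| => x; nia.
rewrite -(pair_big_dep xpredT (fun U D => admissible k U D) term) /=.
apply: (@le_trans _ _ (\sum_(U : {set 'I_n} | (n - #|U| < k)%N || (#|U| == k))
    q `^ E * n%:R ^- (k + 3) * expR 1)).
  rewrite [leRHS]big_mkcond; apply: ler_sum => U _.
  case: ifPn => hU.
    apply: le_trans (ler_wpM2l _ (sum_subset_inv_card R n0)); last first.
      by rewrite mulr_ge0 ?powR_ge0 // invr_ge0 exprn_ge0.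
    rewrite mulr_sumr [leRHS](bigID (admissible k U)) /=; apply: ler_wpDr.
      by apply: sumr_ge0 => D _; rewrite !mulr_ge0 ?powR_ge0 // invr_ge0 exprn_ge0.
    by apply: ler_sum => D /termE; rewrite mulrAC.
  rewrite big_pred0 // => D; apply/negbTE; apply: contra hU => /and4P[_ _ _].
  by case/orP => [->//|/andP[-> _]]; rewrite orbT.
rewrite -[X in \sum_(_ | _) X]mulr1 -mulr_sumr.
apply: le_trans (ler_wpM2l _ (card_admissible_supersets_le R k n0)) _.
  by rewrite !mulr_ge0 ?powR_ge0 ?expR_ge0 // invr_ge0 exprn_ge0.
have -> : q `^ E * n%:R ^- (k + 3) * expR 1 * (2 * expR 1 * n%:R ^+ k) =
   q `^ E * ((expR 1 * 2 * expR 1) / n%:R ^+ 3).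
  rewrite exprD; field; rewrite expf_neq0 ?gt_eqF //.
rewrite ger_pMr ?powR_gt0 // ler_pdivrMr ?exprn_gt0 // mul1r.
rewrite exprS expr2 -mulrA; apply: ler_pM; rewrite ?expR_ge0 ?mulr_ge0 ?expR_ge0 //.
by apply: ler_pM; rewrite ?expR_ge0 // ler_nat.
Qed.

End Tail.

Local Open Scope classical_set_scope.

(** * Estimates of the exponent *)

Lemma natr_le_powR_onem (R : realType) (n : nat) (p : R) : (0 < n)%N -> 0 < p < 1 ->
  n%:R <= (1 - p) `^ (- (ln n%:R / p)).
Proof.
move=> n0 /andP[p0 p1]; have q0 : 0 < 1 - p by rewrite subr_gt0.
have nE : n%:R = expR (ln n%:R) :> R by rewrite lnK // posrE ltr0n.
rewrite {1}nE /powR gt_eqF // ler_expR.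
have h : ln (1 - p) <= - p by apply: le_ln1Dx; lra.
have ln0 : 0 <= ln n%:R / p :> R by rewrite divr_ge0 ?ln_ge0 ?ler1n // ltW.
rewrite mulNr -mulrN; apply: le_trans (ler_wpM2l ln0 (_ : p <= _)); last lra.
by rewrite divfK // gt_eqF.
Qed.

(** Here s stands for the square root of n and 2 a0 for k, while [c] collects the losses
    proportional to a. All losses are small multiples of t s or t s^2, and t = d/60 leaves ample
    slack. *)
Lemma exponent_bound_real (R : realType) (s t L d r a0 u a : R) :
  let c := 2 * r + 4 * (r * L) + L in
  0 < d -> d <= 1 -> 60 * t = d -> 60 <= d * s -> 60 <= s -> 1 <= r -> 1 <= L ->
  r * L <= t * s -> 2 * s <= a0 -> a0 <= 2 * s + 1 -> 1 <= a -> 2 * a <= u ->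
  s ^+ 2 <= u + 2 * a0 \/ u = 2 * a0 /\ a = a0 ->
  (1 - d) * s ^+ 2 <= a * (u - a - c) - (2 * a0 + 3) * L.
Proof.
move=> c d0 d1 tE sd s60 r1 L1 rL a0ge a0le a1 au cases.
have rrL : r <= r * L by rewrite ler_peMr // (le_trans ler01).
have LrL : L <= r * L by rewrite ler_peMl // (le_trans ler01).
have c7 : c <= 7 * (t * s) by rewrite /c; move: (r * L) rrL LrL rL => y; lra.
clearbody c.
have Lts : L <= t * s by apply: le_trans rL.
have kL : (2 * a0 + 3) * L <= 5 * (t * s ^+ 2).
  have -> : 5 * (t * s ^+ 2) = (5 * s) * (t * s) by ring.
  by apply: ler_pM => //; lra.
have ts : 60 * (t * s) = d * s by rewrite -tE; ring.
have tss : 60 * (t * s ^+ 2) = d * s ^+ 2 by rewrite -tE; ring.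
have ds : d * s <= s by rewrite ler_piMl //; lra.
have dss : d * s ^+ 2 <= s ^+ 2 by rewrite ler_piMl // exprn_ge0 //; lra.
have dss' : 60 * s <= d * s ^+ 2 by rewrite expr2 mulrA ler_wpM2r //; lra.
have ss : 60 * s <= s ^+ 2 by rewrite expr2 ler_wpM2r //; lra.
rewrite mulrBl mul1r.
move: (t * s) ts c7 Lts => ts tsE c7 Lts.
case: cases => [us|[uE aE]].
(* The quadratic a(u-a-c) takes the value u-c-1 at a = 1 and exceeds it by exactly this product, so
   a single vertex is the worst case. *)
- have h : 0 <= (a - 1) * (u - c - a - 1) by apply: mulr_ge0; lra.
  have h2 : u - c - 1 <= a * (u - a - c) by rewrite -subr_ge0; move: h; congr (_ <= _); ring.
  move: ((2 * a0 + 3) * L) (a * _) h2 kL => x y h2 kL.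
  lra.
(* Two halves of size a0 >= 2s give a main term of 4 s^2, well above the required s^2. *)
- rewrite uE aE.
  have h : 2 * s * (2 * s - 7 * ts) <= a0 * (2 * a0 - a0 - c).
    by apply: ler_pM; lra.
  have h3 : 2 * s * (2 * s - 7 * ts) = 4 * s ^+ 2 - 14 * (s * ts) by ring.
  have h4 : 60 * (s * ts) = d * s ^+ 2 by rewrite mulrCA tsE expr2; ring.
  rewrite h3 in h.
  move: ((2 * a0 + 3) * L) (a0 * _) h kL => x y h kL.
  lra.
Qed.

Lemma exponent_bound (R : realType) (n r a0 : nat) (s L d : R) u a :
  0 < d <= 1 -> 60 <= d * s -> 60 <= s -> s ^+ 2 = n%:R -> (0 < r)%N -> 1 <= L ->
  r%:R * L <= d / 60 * s -> 2 * s <= a0%:R -> a0%:R <= 2 * s + 1 ->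
  (0 < a)%N -> (2 * a <= u <= n)%N ->
  (n - u < 2 * a0)%N || (u == 2 * a0)%N && (2 * a == 2 * a0)%N ->
  (1 - d) * n%:R <= a%:R * (u%:R - a%:R) - (2 * r * a)%:R
     - (4 * r * a + a + 2 * a0 + 3)%:R * L.
Proof.
move=> /andP[d0 d1] sd s60 sE r0 L1 rL a0ge a0le a1 /andP[au un] cases.
have -> : a%:R * (u%:R - a%:R) - (2 * r * a)%:R - (4 * r * a + a + 2 * a0 + 3)%:R * L =
   a%:R * (u%:R - a%:R - (2 * r%:R + 4 * (r%:R * L) + L)) - (2 * a0%:R + 3) * L.
  by rewrite !natrD !natrM; ring.
rewrite -sE; apply: (@exponent_bound_real _ s (d / 60) L d) => //; rewrite ?ler1n //.
- by field.
- by rewrite -natrM ler_nat.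
- case/orP: cases => [nu|/andP[/eqP uE /eqP aE]]; [left|right].
    by rewrite sE -natrM -natrD ler_nat; move: nu un; clear; lia.
  by rewrite uE natrM; split=> //; congr (_%:R); move: aE; clear; lia.
Qed.

Lemma gnp_prob_no_ham_le (R : realType) (n r : nat) (p d : R) :
  0 < d <= 1 -> expR 1 <= n%:R :> R -> 60 <= d * Num.sqrt n%:R -> (0 < r)%N ->
  0 < p < 1 -> r%:R * (ln n%:R / p) <= d / 60 * Num.sqrt n%:R ->
  gnp_prob p (fun G : {set {set 'I_n}} => ~ has_r_edge_disjoint_ham r G)
    <= (1 - p) `^ ((1 - d) * n%:R).
Proof.
move=> d01 en sd r0 p01 rL; have /andP[p0 p1] := p01.
set s := Num.sqrt n%:R in sd rL.
have s0 : 0 <= s by apply: sqrtr_ge0.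
have s60 : 60 <= s by apply: le_trans sd _; rewrite ler_piMl //; case/andP: d01.
have sE : s ^+ 2 = n%:R by rewrite sqr_sqrtr.
have n3 : (2 < n)%N by rewrite -(ltr_nat R) -sE expr2; nra.
have n0 : (0 < n)%N by apply: ltn_trans n3.
set L := ln n%:R / p in rL.
have lnn1 : 1 <= ln n%:R :> R.
  by rewrite -[leLHS]expRK ler_ln ?posrE ?expR_gt0 ?ltr0n.
have L1 : 1 <= L by rewrite ler_pdivlMr // mul1r (le_trans _ lnn1) // ltW.
(* This is the half-size k/2, about twice the square root of n; the successor ensures 2s <= a0. *)
pose a0 := (Num.truncn (2 * s)).+1.
have /andP[tl tu] : (Num.truncn (2 * s))%:R <= 2 * s < (Num.truncn (2 * s)).+1%:R.
  by apply: truncn_itv; rewrite mulr_ge0.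
have a0le : a0%:R <= 2 * s + 1 by rewrite /a0 -[leLHS]natr1 lerD2r.
apply: (@le_trans _ _ (gnp_prob p (fun G : {set {set 'I_n}} => ~ robust (2 * a0) r G))).
  apply: gnp_prob_le => [||G gG]; rewrite ?ltW //.
  by apply: contra_not; apply: robust_has_r_edge_disjoint_ham.
apply: (@gnp_prob_not_robust R n p L) => //.
- exact: ltW.
- exact: le_trans L1.
- exact: natr_le_powR_onem.
- exact: ltnW.
- by move=> u a; apply: (exponent_bound (s := s)) => //; apply: ltW.
Qed.

(** * Passage to the limit *)

Theorem theorem6 (R : realType) (eps : R) (p : nat -> R) (r : nat -> nat) :
  0 < eps < 1 ->
  (forall n, 0 <= p n <= 1 - eps) ->
  (forall n, (0 < r n)%N) ->
  (fun n : nat => p n * Num.sqrt (n%:R) / ((r n)%:R * ln (n%:R))) @ \oo --> +oo ->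
  exists e : nat -> R,
    e @ \oo --> 0 /\
    \forall n \near \oo,
      @gnp_prob R n (p n) (fun G => ~ has_r_edge_disjoint_ham (r n) G)
      = powR (1 - p n) ((1 + e n) * n%:R).
Proof.
move=> /andP[eps0 _] pE r0 /cvgryPge plim.
pose P n := @gnp_prob R n (p n) (fun G => ~ has_r_edge_disjoint_ham (r n) G).
have p1 n : p n < 1 by have /andP[_ h] := pE n; apply: le_lt_trans h _; lra.
have bounds (d : R) : 0 < d <= 1 -> \forall n \near \oo,
    [/\ (0 < n)%N, 0 < p n, (1 - p n) ^+ n.-1 <= P n
      & P n <= (1 - p n) `^ ((1 - d) * n%:R)].
  move=> d01; have /andP[d0 d1] := d01.
  have d60 : 0 < 60 / d by rewrite divr_gt0.
  near=> n.
  have en : expR 1 <= n%:R :> R by near: n; apply: nbhs_infty_ger.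
  have n0 : (0 < n)%N by rewrite -(ltr_nat R); apply: lt_le_trans en; exact: expR_gt0.
  have lnn1 : 1 <= ln n%:R :> R.
    by rewrite -[leLHS]expRK ler_ln ?posrE ?expR_gt0 ?ltr0n.
  (* Rearranged, this is the bound of r (ln n)/p by d/60 times the square root of n. It also forces
     p n > 0. *)
  have ratio : 60 / d <= p n * Num.sqrt n%:R / ((r n)%:R * ln n%:R).
    by near: n; apply: plim.
  have den : 0 < (r n)%:R * ln n%:R :> R.
    by rewrite mulr_gt0 ?ltr0n // (lt_le_trans _ lnn1).
  have pn0 : 0 < p n.
    have /andP[pge _] := pE n; rewrite lt_neqAle pge andbT eq_sym.
    apply/eqP => p_0; move: ratio; rewrite p_0 !mul0r; lra.
  split => //; first exact: (gnp_prob_no_ham_ge (ltW pn0) (p1 n) n0 (r0 n)).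
  apply: gnp_prob_no_ham_le; rewrite ?pn0 ?p1 //.
    have : (60 / d) ^+ 2 <= n%:R by near: n; apply: nbhs_infty_ger.
    move=> /ler_wsqrtr; rewrite sqrtr_sqr gtr0_norm // ler_pdivrMr // mulrC.
    exact.
  move: ratio; rewrite ler_pdivlMr // => ratio.
  rewrite mulrA ler_pdivrMr //.
  have -> : d / 60 * Num.sqrt n%:R * p n = d / 60 * (p n * Num.sqrt n%:R) by ring.
  apply: le_trans (ler_wpM2l _ ratio); last by rewrite divr_ge0 // ltW.
  rewrite mulrA; have -> : d / 60 * (60 / d) = 1 by field; rewrite gt_eqF.
  by rewrite mul1r.
(* The required equation solved for the error term. *)
pose e n := ln (P n) / (n%:R * ln (1 - p n)) - 1.
exists e; split.
  apply/cvgrPdist_le => d d0.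
  (* The tolerance is capped at 1 to fit [bounds]. *)
  have dm : 0 < Num.min d 1 <= 1 by rewrite lt_min d0 ltr01 ge_min lexx orbT.
  near=> n.
  have [n0 pn0 lo up] : [/\ (0 < n)%N, 0 < p n, (1 - p n) ^+ n.-1 <= P n
      & P n <= (1 - p n) `^ ((1 - Num.min d 1) * n%:R)].
    by near: n; apply: bounds.
  have q0 : 0 < 1 - p n by rewrite subr_gt0.
  have lq : ln (1 - p n) < 0 by rewrite ln_lt0 // q0 /=; lra.
  have N0 : 0 < n%:R :> R by rewrite ltr0n.
  have P0 : 0 < P n by apply: lt_le_trans lo; rewrite exprn_gt0.
  have lnup : ln (P n) <= (1 - Num.min d 1) * n%:R * ln (1 - p n).
    by rewrite -ln_powR ler_ln ?posrE ?powR_gt0.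
  have lnlo : n%:R * ln (1 - p n) <= ln (P n).
    rewrite -ln_powR ler_ln ?posrE ?powR_gt0 // powR_mulrn ?(ltW q0) //.
    apply: le_trans lo; apply: ler_wiXn2l; rewrite ?(ltW q0) ?leq_pred //; lra.
  have nl : n%:R * ln (1 - p n) < 0 by rewrite pmulr_rlt0.
  (* Dividing by the negative n ln(1-p) reverses inequalities: the lower bound on P gives e <= 0,
     the upper one -d <= e. *)
  have e0 : e n <= 0 by rewrite /e subr_le0 ler_ndivrMr // mul1r.
  rewrite sub0r normrN ler0_norm // lerNl /e.
  rewrite lerBrDr ler_ndivlMr //; apply: le_trans lnup _.
  rewrite -mulrA ler_wnM2r ?(ltW nl) //.
  by rewrite addrC lerD2l lerN2 ge_min lexx.
(* The identity only needs n, p and P to be positive, so [bounds] with d = 1 suffices. *)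
have : (0 : R) < (1 : R) <= (1 : R) by rewrite ltr01 /=.
move=> /bounds; apply: filterS => n [n0 pn0 lo _].
have q0 : 0 < 1 - p n by rewrite subr_gt0.
have lq : ln (1 - p n) < 0 by rewrite ln_lt0 // q0 /=; lra.
have P0 : 0 < P n by apply: lt_le_trans lo; rewrite exprn_gt0.
rewrite -/(P n) /powR gt_eqF // /e addrC subrK.
rewrite -mulrA -[X in X * (n%:R * _)]/(_ / _) divfK ?lnK //.
by rewrite mulf_neq0 ?pnatr_eq0 -?lt0n // lt_eqF.
Unshelve. all: by end_near.
Qed.
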